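(* Let $X,Z$ be Banach spaces, $Y$ a real normed vector space, $K\subset Y$ a proper convex cone with $\operatorname{int}K\neq\emptyset$, $Q\subset Z$ a closed convex pointed cone, $L\subset S_X$ a nonempty closed set, and $f:X\to Y$, $g:X\to Z$ continuously Fréchet differentiable functions. Suppose that $\overline{x}\in g^{-1}(-Q)$ is a local weak directional Pareto minimum point for $f$ on $g^{-1}(-Q)$ with respect to $L$. Moreover, suppose that $\psi:X\times Z\to Z$, $\psi(x,z):=g(x)-z$, is metrically subregular at $(\overline{x},g(\overline{x}),0)$ with respect to $(\overline{x}+\operatorname{cone}L)\times(-Q)$. Then for all $u\in\operatorname{cone}L$ with $\nabla g(\overline{x})(u)\in T_B(-Q,g(\overline{x}))$, $$\nabla f(\overline{x})(u)\notin-\operatorname{int}K .$$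
   Context: $S_X$ is the unit sphere of $X$; $\operatorname{cone}C=\{tc\mid t\ge0,\ c\in C\}$. A convex cone $K$ is proper if $K\neq\{0\}$ and $K\neq Y$ (not necessarily pointed); $Q$ pointed means $Q\cap(-Q)=\{0\}$. $\nabla f(\overline{x})$ is the Fréchet derivative. Products carry the sum norm. Local weak directional Pareto minimum: with $A=g^{-1}(-Q)$, $\overline{x}\in A$ is a local weak directional Pareto minimum point for $f$ on $A$ with respect to $L$ if there is a neighborhood $U$ of $\overline{x}$ such that $f(x)-f(\overline{x})\notin-\operatorname{int}K$ for all $x\in U\cap A\cap(\overline{x}+\operatorname{cone}L)$. Metric subregularity with respect to a set: a function $h:W\to V$ between normed spaces is metrically subregular at $(\overline{w},h(\overline{w}))\in D\times V$ with respect to a nonempty closed set $D\subset W$ if there exist $s>0$, $\mu>0$ such that for every $w\in B(\overline{w},s)\cap D$, $d(w,h^{-1}(h(\overline{w}))\cap D)\le\mu\|h(\overline{w})-h(w)\|$. Here this is applied to $h=\psi$, $\overline{w}=(\overline{x},g(\overline{x}))$, $\psi(\overline{w})=0$ and $D=(\overline{x}+\operatorname{cone}L)\times(-Q)$. Bouligand tangent cone: $T_B(E,\overline{z})$ is the set of all $v$ for which there are $v_n\to v$ and $(t_n)\subset(0,\infty)$ with $t_n\to0$ such that $\overline{z}+t_nv_n\in E$ for all $n$. *)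

(* Defs.v *)
From HB Require Import structures.
From mathcomp Require Import all_boot all_order all_algebra.
From mathcomp Require Import all_classical all_reals all_analysis.

Set Implicit Arguments.
Unset Strict Implicit.
Unset Printing Implicit Defensive.

Import Order.TTheory GRing.Theory Num.Theory.
Import numFieldNormedType.Exports.

Local Open Scope classical_set_scope.
Local Open Scope ring_scope.

(* The library norms [X * Z] by the maximum of the component norms; [l1prod X Z]
   is the same module with the sum norm. *)
Definition l1prod (X Z : Type) : Type := (X * Z)%type.

Section l1prod_normed.
Context {R : realType} {X Z : normedModType R}.

HB.instance Definition _ := GRing.Lmodule.copy (l1prod X Z) (X * Z)%type.

Definition l1norm (p : l1prod X Z) : R := `|p.1| + `|p.2|.

Lemma l1normD (p q : l1prod X Z) : l1norm (p + q) <= l1norm p + l1norm q.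
Proof. by rewrite /l1norm addrACA lerD// ler_normD. Qed.

Lemma l1normZ (a : R) (p : l1prod X Z) : l1norm (a *: p) = `|a| * l1norm p.
Proof. by rewrite /l1norm !normrZ mulrDr. Qed.

Lemma l1norm_eq0 (p : l1prod X Z) : l1norm p = 0 -> p = 0.
Proof.
case: p => x z /eqP; rewrite /l1norm paddr_eq0 ?normr_ge0//= !normr_eq0.
by case/andP => /eqP -> /eqP ->.
Qed.

HB.instance Definition _ :=
  Lmodule_isNormed.Build R (l1prod X Z) l1normD l1normZ l1norm_eq0.

Lemma l1prod_normE (p : l1prod X Z) : `|p| = `|p.1| + `|p.2|.
Proof. by []. Qed.

End l1prod_normed.

Section cones.
Context {R : realType} {V : normedModType R}.
Implicit Types (C K Q E : set V) (v z : V).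

Definition unit_sphere : set V := [set v | `|v| = 1].

Definition opp_set C : set V := -%R @` C.

Definition translate v C : set V := [set v + c | c in C].

Definition cone C : set V :=
  [set t *: c | t in [set t : R | 0 <= t] & c in C].

Definition convex_cone K : Prop :=
  [/\ K !=set0, forall (t : R) v, 0 <= t -> K v -> K (t *: v) & convex_set K].

Definition proper_cone K : Prop := K <> [set 0] /\ K <> [set: V].

Definition pointed_cone Q : Prop := Q `&` opp_set Q = [set 0].

Definition bouligand_tangent_cone E z : set V :=
  [set v | exists (v_ : nat -> V) (t_ : nat -> R),
    [/\ v_ @ \oo --> v, forall n, 0 < t_ n, t_ @ \oo --> (0 : R) &
        forall n, E (z + t_ n *: v_ n)]].

End cones.

Arguments unit_sphere {R V}.

Section maps.
Context {R : realType}.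

(* Meaningful for bounded linear maps only: [sup] of an unbounded set is 0. *)
Definition operator_norm {V W : normedModType R} (T : V -> W) : R :=
  sup [set `|T v| | v in [set v | `|v| <= 1]].

Definition continuously_differentiable {V W : normedModType R} (f : V -> W)
    : Prop :=
  (forall x, differentiable f x) /\
  (forall x, operator_norm ('d f y \- 'd f x) @[y --> x] --> (0 : R)).

Definition local_weak_directional_pareto_min {X Y : normedModType R}
    (K : set Y) (f : X -> Y) (A L : set X) (xbar : X) : Prop :=
  A xbar /\
  exists2 U : set X, nbhs xbar U &
    forall x, (U `&` A `&` translate xbar (cone L)) x ->
      ~ opp_set K° (f x - f xbar).

(* [edist_inf S w] is d(w, S); see [edist_inf_normE] *)
Definition metrically_subregular {W V : normedModType R} (h : W -> V) (w : W)
    (D : set W) : Prop :=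
  exists s mu : R, [/\ 0 < s, 0 < mu &
    forall w', (ball w s `&` D) w' ->
      (edist_inf (h @^-1` [set h w] `&` D) w' <= (mu * `|h w - h w'|)%:E)%E].

Definition psi {X Z : normedModType R} (g : X -> Z) (p : l1prod X Z) : Z :=
  g p.1 - p.2.

Lemma edist_normE {V : normedModType R} (x y : V) :
  edist (x, y) = `|x - y|%:E.
Proof.
apply/eqP; rewrite eq_le; apply/andP; split.
  apply/lee_addgt0Pr => e e0; rewrite -EFinD; apply: edist_fin.
    by rewrite ltr_wpDl.
  by rewrite -ball_normE /ball_ /= ltrDl.
apply: le_ereal_inf_tmp => _ [r [_ +] <-].
by rewrite -ball_normE /ball_ /= lee_fin => /ltW.
Qed.

Lemma edist_inf_normE {V : normedModType R} (S : set V) (w : V) :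
  edist_inf S w = ereal_inf [set `|w - a|%:E | a in S].
Proof.
rewrite /edist_inf; congr ereal_inf.
by apply: eq_imagel => a _; rewrite edist_normE.
Qed.

End maps.

(* Main.v *)
(* Move from xbar to [xbar + t_n u] and from g(xbar) to [g(xbar) + t_n v_n],
   where v_n --> g'(xbar) u.  The constraint defect of these points is o(t_n),
   so metric subregularity corrects them to feasible points
   [xbar + t_n u_n] in the directions of L with u_n --> u.  The difference
   quotients of f along the corrected points converge to f'(xbar) u; if this
   limit were in the open cone [- int K], the corrected points would eventually
   contradict minimality. *)

Require Import Defs.
From HB Require Import structures.
From mathcomp Require Import all_boot all_order all_algebra.
From mathcomp Require Import all_classical all_reals all_analysis.

Set Implicit Arguments.
Unset Strict Implicit.
Unset Printing Implicit Defensive.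

Import Order.TTheory GRing.Theory Num.Theory.
Import numFieldNormedType.Exports.

Local Open Scope classical_set_scope.
Local Open Scope ring_scope.

(** Fréchet differentiability allows the direction to vary: since [u_] is bounded, the first-order
    remainder at [t_ n *: u_ n] is o([t_ n]), and the linear part converges because the differential
    is continuous. *)
Lemma hadamard_quotient_cvg (R : realType) (V W : normedModType R) (f : V -> W)
    (x u : V) (u_ : nat -> V) (t_ : nat -> R) :
    differentiable f x -> (forall n, 0 < t_ n) -> t_ @ \oo --> (0 : R) ->
    u_ @ \oo --> u ->
  (fun n => (t_ n)^-1 *: (f (x + t_ n *: u_ n) - f x)) @ \oo --> 'd f x u.
Proof.
move=> df t0 tcvg ucvg.
have tucvg : (fun n => t_ n *: u_ n) @ \oo --> (0 : V).
  by rewrite -(scale0r u); exact: cvgZ.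
have dcvg : (fun n => 'd f x (u_ n)) @ \oo --> 'd f x u.
  by apply: cvg_comp ucvg _; exact: (diff_continuous df).
pose r n := (t_ n)^-1 *: (f (x + t_ n *: u_ n) - f x) - 'd f x (u_ n).
suff rcvg : r @ \oo --> (0 : W).
  rewrite -[X in _ --> X]add0r.
  under eq_fun => n do rewrite -(subrK ('d f x (u_ n)) (_ *: _)).
  exact: cvgD rcvg dcvg.
have bnd : \forall n \near \oo, `|u_ n| <= `|u| + 1.
  have /cvgrPdist_le/(_ 1 ltr01) := ucvg.
  apply: filterS => n h; rewrite -lerBlDl; apply: le_trans h.
  by rewrite distrC lerB_dist.
have u1 : 0 < `|u| + 1 by rewrite ltr_wpDl.
apply/cvgr0Pnorm_le => e e0.
have /eqaddoP o := diff_locally df.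
(* Dividing the tolerance by [|u| + 1] absorbs the eventual bound on [|u_ n|]. *)
have {}o := o _ (divr_gt0 e0 u1).
have {}o : \forall n \near \oo, `|f (t_ n *: u_ n + x) -
    (f x + 'd f x (t_ n *: u_ n))| <= e / (`|u| + 1) * `|t_ n *: u_ n|.
  exact: tucvg o.
near=> n.
have tn := t0 n.
have -> : r n =
    (t_ n)^-1 *: (f (t_ n *: u_ n + x) - (f x + 'd f x (t_ n *: u_ n))).
  rewrite /r linearZ/= opprD addrA [in RHS]scalerBr scalerA mulVf ?gt_eqF// scale1r.
  by rewrite (addrC x).
rewrite normrZ gtr0_norm ?invr_gt0// ler_pdivrMl//.
have : `|f (t_ n *: u_ n + x) - (f x + 'd f x (t_ n *: u_ n))| <=
  e / (`|u| + 1) * `|t_ n *: u_ n| by near: n.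
move=> /le_trans; apply.
rewrite normrZ gtr0_norm// mulrCA ler_pM2l// -mulrA ler_piMr ?(ltW e0)//.
by rewrite ler_pdivrMl// mulr1; near: n.
Unshelve. all: by end_near. Qed.

(** The preimage of [K] under scaling by [t^-1] is a neighborhood of [t *: v], and the cone property
    puts it inside [K]. *)
Lemma interior_coneZ (R : realType) (V : normedModType R) (K : set V) (t : R)
    (v : V) :
  convex_cone K -> 0 < t -> K° v -> K° (t *: v).
Proof.
move=> [_ KZ _] t0 Kv.
have c : t^-1 *: z @[z --> t *: v] --> v.
  rewrite -[X in _ --> X]scale1r -(mulVf (lt0r_neq0 t0)) -scalerA.
  exact: scaler_continuous.
have Kt : nbhs (t *: v) [set z | K (t^-1 *: z)] := c _ Kv.
apply: filterS Kt => z Kz.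
by have := KZ t _ (ltW t0) Kz; rewrite scalerA mulfV ?gt_eqF// scale1r.
Qed.

Theorem theorem3p11 (R : realType) (X Z : completeNormedModType R)
  (Y : normedModType R) (K : set Y) (Q : set Z) (L : set X)
  (f : X -> Y) (g : X -> Z) (xbar : X)
  (K_cone : convex_cone K) (K_proper : proper_cone K) (K_int : K° !=set0)
  (Q_cone : convex_cone Q) (Q_closed : closed Q) (Q_pointed : pointed_cone Q)
  (L_sphere : L `<=` unit_sphere) (L_neq0 : L !=set0) (L_closed : closed L)
  (f_C1 : continuously_differentiable f)
  (g_C1 : continuously_differentiable g)
  (xbar_feas : (g @^-1` opp_set Q) xbar)
  (xbar_min : local_weak_directional_pareto_min K f (g @^-1` opp_set Q) L xbar)
  (psi_subreg : metrically_subregular (psi g) ((xbar, g xbar) : l1prod X Z)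
                  (translate xbar (cone L) `*` opp_set Q)) :
  forall u : X, cone L u ->
    bouligand_tangent_cone (opp_set Q) (g xbar) ('d g xbar u) ->
    ~ opp_set K° ('d f xbar u).
Proof.
move=> u Lu [v_ [t_ [vcvg t0 tcvg Qv]]] dfu.
have [s [mu [s0 mu0 subreg]]] := psi_subreg.
have [_ [U Unbhs Umin]] := xbar_min.
set wbar : l1prod X Z := (xbar, g xbar).
pose w n : l1prod X Z := (xbar + t_ n *: u, g xbar + t_ n *: v_ n).
have psi0 : psi g wbar = 0 by rewrite /psi subrr.
pose D : set (l1prod X Z) := translate xbar (cone L) `*` opp_set Q.
have wD n : D (w n).
  split => //=; have [r /= r0 [c Lc <-]] := Lu.
  exists (t_ n *: (r *: c)) => //; exists (t_ n * r); first exact: mulr_ge0 (ltW _) _.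
  by exists c => //; rewrite scalerA.
have wball : \forall n \near \oo, ball wbar s (w n).
  have tu : (fun n => t_ n *: u) @ \oo --> (0 : X).
    by rewrite -(scale0r u); apply: cvgZ => //; exact: cvg_cst.
  have tv : (fun n => t_ n *: v_ n) @ \oo --> (0 : Z).
    by rewrite -(scale0r ('d g xbar u)); exact: cvgZ.
  have s2 : 0 < s / 2 by rewrite divr_gt0.
  have /cvgr0Pnorm_lt/(_ _ s2) nu := tu.
  have /cvgr0Pnorm_lt/(_ _ s2) nv := tv.
  near=> n; rewrite -ball_normE /ball_ /= distrC l1prod_normE /=.
  rewrite (addrC xbar) (addrC (g xbar)) !addrK (splitr s) ltrD//; by near: n.
(* The distance is an infimum that may not be attained; the slack [t_ n / (n + 1)] yields an actual
   point and is still o([t_ n]). Outside the ball the claim is vacuous and [wbar] is a dummy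
   value. *)
have correct n : exists p : l1prod X Z, ball wbar s (w n) ->
    [/\ D p, psi g p = 0 &
        `|w n - p| < mu * `|psi g (w n)| + t_ n * n.+1%:R^-1].
  have [wn|] := pselect (ball wbar s (w n)); last by exists wbar.
  have := subreg _ (conj wn (wD n)).
  rewrite edist_inf_normE psi0 sub0r normrN => le_d.
  have e0 : 0 < t_ n * n.+1%:R^-1 by rewrite mulr_gt0// invr_gt0.
  have : (ereal_inf [set `|w n - a|%:E | a in psi g @^-1` [set 0%R] `&` D] <
     (mu * `|psi g (w n)| + t_ n * n.+1%:R^-1)%:E)%E.
    by apply: le_lt_trans le_d _; rewrite lte_fin ltrDl.
  by move=> /ereal_inf_lt[_ [p [pp Dp] <-]]; rewrite lte_fin; exists p.
have [p pP] := choice correct.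
pose u_ n := (t_ n)^-1 *: ((p n).1 - xbar).
have p1E n : (p n).1 = xbar + t_ n *: u_ n.
  by rewrite /u_ scalerA mulfV ?gt_eqF// scale1r addrC subrK.
(* The scaled defect is the difference quotient of [g] along [u] minus [v_ n]; both tend to
   ['d g xbar u]. *)
have defect : (fun n => (t_ n)^-1 *: psi g (w n)) @ \oo --> (0 : Z).
  have ucst : (fun=> u) @ \oo --> u by exact: cvg_cst.
  have dg := hadamard_quotient_cvg (g_C1.1 xbar) t0 tcvg ucst.
  rewrite -(subrr ('d g xbar u)); under eq_fun => n.
    rewrite /psi /= opprD addrA scalerBr scalerA mulVf ?gt_eqF// scale1r; over.
  exact: cvgB dg vcvg.
have ucvg : u_ @ \oo --> u.
  (* This is the bound on [|w n - p n|] divided by [t_ n]. It controls [|u - u_ n|] because the sum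
     norm dominates the norm of the first component, [t_ n *: (u - u_ n)]. *)
  have radius : (fun n => mu * `|(t_ n)^-1 *: psi g (w n)| + n.+1%:R^-1)
      @ \oo --> (0 : R).
    rewrite (_ : 0 = mu * `|0 : Z| + 0); last by rewrite normr0 mulr0 addr0.
    apply: cvgD; last exact: cvg_harmonic.
    by apply: cvgM; [exact: cvg_cst|exact: cvg_norm].
  apply/cvgrPdist_lt => e e0.
  have /cvgr0Pnorm_lt/(_ _ e0) small := radius.
  near=> n.
  have wn : ball wbar s (w n) by near: n.
  have [_ _ pn] := pP n wn.
  apply: (@lt_trans _ _ (mu * `|(t_ n)^-1 *: psi g (w n)| + n.+1%:R^-1)).
    rewrite normrZ gtr0_norm ?invr_gt0// -(ltr_pM2l (t0 n)) mulrDr.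
    rewrite (mulrCA (t_ n) mu) mulVKf ?gt_eqF//.
    apply: le_lt_trans pn; rewrite l1prod_normE /= p1E opprD addrACA subrr add0r.
    by rewrite -scalerBr normrZ gtr0_norm// lerDl.
  by apply: le_lt_trans (ler_norm _) _; near: n.
have pcvg : (fun n => (p n).1) @ \oo --> xbar.
  rewrite -[X in _ --> X]addr0 -(scale0r u).
  under eq_fun do rewrite p1E.
  by apply: cvgD; [exact: cvg_cst|exact: cvgZ].
have fcvg := hadamard_quotient_cvg (f_C1.1 xbar) t0 tcvg ucvg.
have Kf : \forall n \near \oo,
    K° (- ((t_ n)^-1 *: (f (xbar + t_ n *: u_ n) - f xbar))).
  have [y Ky yE] := dfu.
  have := cvgN fcvg; apply; rewrite -yE opprK.
  exact: (open_nbhs_nbhs (conj (@open_interior _ K) Ky)).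
near \oo => n.
have wn : ball wbar s (w n) by near: n.
have [[Lp Qp] psip _] := pP n wn.
(* Feasibility holds because a zero of [psi g] has second component [g (p n).1], which membership in
   [D] places in [opp_set Q]. *)
apply: (Umin (p n).1).
  split => //; split; first by near: n; exact: pcvg Unbhs.
  by move/subr0_eq: psip => /= ->.
have : K° (- ((t_ n)^-1 *: (f (xbar + t_ n *: u_ n) - f xbar))) by near: n.
(* Scaling by [t_ n] turns the quotient back into the increment of [f]. *)
move=> /(interior_coneZ K_cone (t0 n)).
rewrite scalerN scalerA mulfV ?gt_eqF// scale1r -p1E => Kn.
by eexists; [exact: Kn|rewrite opprK].
Unshelve. all: by end_near.
Qed.
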